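(* Let $G$ be an Eulerian graph and let $i$ be an integer-valued function on $V(G)$ such that $|E(G)|\equiv t \pmod 2$, where $t=\sum_{v\in V(G)}|i(v)|$. If $G$ is $(2t-1)$-edge-connected and $bi(G)\ge t-1$, then $G$ has a factor $F$ such that for each vertex $v$, $$d_F(v)=\frac{d_G(v)}{2}+i(v).$$
   Context: Graphs may have loops and multiple edges. A graph is Eulerian if every vertex has even degree. A factor of $G$ is a spanning subgraph of $G$; $d_H(v)$ denotes the degree of $v$ in $H$. For $X\subseteq V(G)$, $e_G(X)$ is the number of edges with both ends in $X$. The bipartite index $bi(G)$ is the minimum of $|E(G)\setminus E(H)|$ over all bipartite spanning induced subgraphs $H$ of $G$; equivalently, the minimum of $e_G(X)+e_G(Y)$ over all bipartitions $X,Y$ of $V(G)$.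
   Formalization: When t = 0, ''(2t-1)-edge-connected'', i.e. (-1)-edge-connected, is read as ''connected''; with no such requirement the claim fails, e.g. for two disjoint triangles with i = 0. For t ≥ 1 nothing is changed. *)

(* Defs.v *)
From mathcomp Require Import all_boot all_order all_algebra.

Set Implicit Arguments.
Unset Strict Implicit.
Unset Printing Implicit Defensive.

(* Finite undirected graphs, with loops and parallel edges allowed.  The order
   of the two components of [ends e] carries no information; [e] is a loop
   when they are equal. *)
Record multigraph := Multigraph {
  vertex : finType;
  edge : finType;
  ends : edge -> vertex * vertex
}.

Section Multigraph.
Variable G : multigraph.
Implicit Types (v : vertex G) (e : edge G).
Implicit Types (X : {set vertex G}) (F S : {set edge G}).

(* A factor (spanning subgraph) of [G] is given by its edge set [F], and [G]
   itself is the factor [setT].  A loop contributes 2 to the degree. *)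
Definition deg F v : nat :=
  \sum_(e in F) (((ends e).1 == v) + ((ends e).2 == v)).

Definition eulerian : Prop := forall v, ~~ odd (deg setT v).

Definition adj F : rel (vertex G) :=
  [rel u v | [exists e in F, (ends e == (u, v)) || (ends e == (v, u))]].

Definition connected F : Prop := forall u v, connect (adj F) u v.

(* The first conjunct only matters for [k = 0]: a [k]-edge-connected graph is
   always taken to be connected. *)
Definition edge_connected (k : nat) : Prop :=
  connected setT /\ forall S, #|S| < k -> connected (~: S).

Definition edges_in X : {set edge G} :=
  [set e | ((ends e).1 \in X) && ((ends e).2 \in X)].

(* The number of edges lost when passing to the spanning bipartite subgraph
   formed by all edges between [X] and its complement. *)
Definition bip_defect X : nat := #|edges_in X| + #|edges_in (~: X)|.

Definition bi : nat := bip_defect [arg min_(X < set0) bip_defect X].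

End Multigraph.

Arguments deg {G} F v.
Arguments adj {G} F.
Arguments connected {G} F.

(* Main.v *)
Require Import Defs.
From mathcomp Require Import all_boot all_order all_algebra.
From mathcomp Require Import zify ring lra.

(** For a degree target [f], give every vertex one of the labels S, T, U and
    charge a factor [F] with excess [x = d_F - f] the total
    [x(S) - x(T) + \sum_U |x|].  If no factor meets the target, the all-U
    labelling makes every total positive; take a labelling with as few U as
    possible that still does, and a factor [F] minimising the total.  Exchanging
    alternating trails between minimisers shows that [|x|] sums to at most 1 over
    each component of [G[U]] (the analogue of Gallai's lemma), and [F] may be
    taken to contain no S-S or S-U edge and all T-T and T-U edges.

    For [f = d/2 + i], counting degrees bounds the total, which is even and hence
    at least 2, by [t - e(S) - e(T) - d(U)/2 + \sum_U |x|].  If U is empty this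
    is at most [t - bi(G) <= 1].  If U is everything it is at most 1, as [G] is
    connected.  Otherwise each component [K] of [G[U]] has an even edge cut,
    so [d(K) >= max(2, 2t)], and again the bound is at most 1. *)

Set Implicit Arguments.
Unset Strict Implicit.
Unset Printing Implicit Defensive.

Import Order.TTheory GRing.Theory Num.Theory.
Local Open Scope ring_scope.

(** * Exchanges between two factors along alternating trails *)

Section Factor.
Variables (G : multigraph) (f : vertex G -> int).
Implicit Types (u v w : vertex G) (e : edge G) (F H : {set edge G}).
Implicit Types (s : int).

Definition inc e v : nat := ((ends e).1 == v) + ((ends e).2 == v).

Lemma degU1 e F v : e \notin F -> deg (e |: F) v = (inc e v + deg F v)%N.
Proof. by move=> eF; rewrite /deg big_setU1. Qed.

Lemma degD1 e F v : e \in F -> deg F v = (inc e v + deg (F :\ e) v)%N.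
Proof. by move=> eF; rewrite /deg (big_setD1 e). Qed.

Lemma degE F v : deg F v = (\sum_e (e \in F) * inc e v)%N.
Proof. by rewrite /deg big_mkcond; apply: eq_bigr => e _; case: (e \in F); rewrite ?mul1n. Qed.

Definition excess F v : int := (deg F v)%:Z - f v.

(** The degrees at [u] force an edge at [u] lying in only one of the factors; switching it in [F]
    brings [F] closer to [F']. If that edge is a loop, [w = u] and the change there is [2s]. *)
Lemma toggle F F' u s : s = 1 \/ s = -1 ->
  0 < s * (excess F' u - excess F u) ->
  exists H w, [/\ (#|H :\: F'| + #|F' :\: H| < #|F :\: F'| + #|F' :\: F|)%N,
    F :&: F' \subset H, H \subset F :|: F' &
    forall v, excess H v = excess F v + s * (u == v)%:Z + s * (w == v)%:Z].
Proof.
have other F1 F2 : (deg F1 u < deg F2 u)%N ->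
    exists e w, [/\ e \in F2 :\: F1 & forall v, inc e v = ((u == v) + (w == v))%N].
  move=> lt12.
  have [e eP inc_e] : exists2 e, e \in F2 :\: F1 & (0 < inc e u)%N.
    apply/exists_inP; apply: contraLR lt12; rewrite negb_exists_in => /forall_inP no.
    rewrite -leqNgt /deg (big_setID F1) /= [X in (_ + X)%N]big1 ?addn0.
      by rewrite [leqRHS](big_setID F2) /= setIC leq_addr.
    by move=> e /no; rewrite -leqNgt leqn0 => /eqP.
  exists e; move: inc_e; rewrite /inc; case: eqP => [<- _|_].
    by exists (ends e).2.
  by case: eqP => // <- _; exists (ends e).1; split=> // v; rewrite addnC.
case=> ->; rewrite ?mul1r ?mulN1r /excess => lt.
  have [|e [w [/setDP[eF' eF] incE]]] := other F F'; first by lia.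
  exists (e |: F), w; split.
  - have -> : (e |: F) :\: F' = F :\: F'.
      by apply/setP=> a; rewrite !inE; case: eqP => // ->; rewrite eF'.
    have -> : F' :\: (e |: F) = (F' :\: F) :\ e.
      by apply/setP=> a; rewrite !inE negb_or andbA.
    by rewrite [X in (_ < _ + X)%N](cardsD1 e) !inE eF eF' /= ltn_add2l.
  - by apply: (subset_trans (subsetIl _ _)); exact: subsetUr.
  - by apply/subsetP=> a; rewrite !inE => /orP[/eqP-> | ->]; rewrite ?eF' ?orbT.
  - by move=> v; rewrite degU1 // incE; lia.
have [|e [w [/setDP[eF eF'] incE]]] := other F' F; first by lia.
exists (F :\ e), w; split.
- have -> : F' :\: (F :\ e) = F' :\: F.
    by apply/setP=> a; rewrite !inE; case: eqP => [->|_] //; rewrite (negPf eF') !andbF.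
  have -> : (F :\ e) :\: F' = (F :\: F') :\ e.
    by apply/setP=> a; rewrite !inE andbCA.
  by rewrite [X in (_ < X + _)%N](cardsD1 e) !inE eF eF' /= ltn_add2r.
- apply/subsetP=> a; rewrite !inE => /andP[-> aF']; rewrite andbT.
  by apply: contraNneq eF' => <-.
- by apply: (subset_trans (subsetDl _ _)); exact: subsetUl.
- by move=> v; rewrite (degD1 v eF) incE; lia.
Qed.

(* The two-step axiom of jump systems, for degree sequences of factors. *)
Lemma alternating_trail F F' u s : s = 1 \/ s = -1 ->
  0 < s * (excess F' u - excess F u) ->
  exists H z (t : int), [/\ F :&: F' \subset H, H \subset F :|: F', t = 1 \/ t = -1,
    forall v, excess H v = excess F v + s * (u == v)%:Z + t * (z == v)%:Z &
    0 < t * (excess F' z - excess F z - s * (u == z)%:Z)].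
Proof.
have [n] := ubnP (#|F :\: F'| + #|F' :\: F|)%N.
elim: n => // n IHn in F u s *; rewrite ltnS => le_n hs lt.
have [H [w [ltH sub_H H_sub xH]]] := toggle hs lt.
(* If [F'] also asks for a step [s] at [w], the trail stops. Otherwise the toggle overshoots at [w],
   and the trail goes on from [w] with [- s], which undoes the change there. *)
case: (ltrP 0 (s * (excess F' w - excess F w - s * (u == w)%:Z))) => [lt'|le'].
  by exists H, w, s.
have [| | |H2 [z [t [sub_H2 H2_sub ht xH2 lt2]]]] := IHn H w (- s).
- exact: leq_trans ltH le_n.
- by case: hs => ->; lia.
- by rewrite xH eqxx; case: hs le' => ->; lia.
exists H2, z, t; split=> //.
- by apply: subset_trans sub_H2; rewrite subsetI sub_H subsetIr.
- by apply: (subset_trans H2_sub); rewrite subUset H_sub subsetUr.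
- by move=> v; rewrite xH2 xH; ring.
- by apply: etrans lt2; rewrite xH; congr (_ < _ * _); ring.
Qed.

(* The labels S, T, U are [Some true], [Some false], [None]. *)
Definition price (o : option bool) (x : int) : int :=
  match o with None => `|x| | Some true => x | Some false => - x end.

Lemma price_convex o x y t : t = 1 \/ t = -1 -> 0 < t * (y - x) ->
  price o (x + t) + price o (y - t) <= price o x + price o y.
Proof. by case: o => [[]|] /= [] ->; lia. Qed.

Variable c : {ffun vertex G -> option bool}.

Definition cost F : int := \sum_v price (c v) (excess F v).

(** [H'] is chosen so that [H] and [H'] together use each edge as often as [F] and [F']; by
    convexity the joint cost away from [u] cannot grow. The prices at [u] stay explicit, since later
    arguments exploit their strict drop when the excesses at [u] have opposite signs. *)
Lemma exchange F F' u s : s = 1 \/ s = -1 ->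
  0 < s * (excess F' u - excess F u) ->
  exists H H' z (t : int), [/\ F :&: F' \subset H, t = 1 \/ t = -1,
    forall v, excess H v = excess F v + s * (u == v)%:Z + t * (z == v)%:Z /\
      excess H' v = excess F' v - s * (u == v)%:Z - t * (z == v)%:Z,
    0 < t * (excess F' z - excess F z - s * (u == z)%:Z) &
    cost H + cost H' - price (c u) (excess H u) - price (c u) (excess H' u)
    <= cost F + cost F' - price (c u) (excess F u) - price (c u) (excess F' u)].
Proof.
move=> hs lt; have [H [z [t [sub_H H_sub ht xH ltz]]]] := alternating_trail hs lt.
pose H' := (F :&: F') :|: ((F :|: F') :\: H).
have degH' v : (deg H v + deg H' v = deg F v + deg F' v)%N.
  rewrite !degE -!big_split; apply: eq_bigr => e _ /=; rewrite -!mulnDl; congr (_ * _)%N.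
  move/subsetP/(_ e): sub_H; move/subsetP/(_ e): H_sub; rewrite !inE.
  by case: (e \in H); case: (e \in F); case: (e \in F') => //= h h';
    first [by have := h isT | by have := h' isT].
have xH' v : excess H' v = excess F' v - s * (u == v)%:Z - t * (z == v)%:Z.
  by have := xH v; have := degH' v; rewrite /excess; lia.
exists H, H', z, t; split=> //.
have costE K : cost K = price (c u) (excess K u) + \sum_(v | v != u) price (c v) (excess K v).
  by rewrite /cost (bigD1 u).
rewrite !costE.
have : \sum_(v | v != u) (price (c v) (excess H v) + price (c v) (excess H' v))
    <= \sum_(v | v != u) (price (c v) (excess F v) + price (c v) (excess F' v)).
  apply: ler_sum => v vu; rewrite xH xH' (eq_sym u) (negPf vu) mulr0 addr0 subr0.
  case: (eqVneq z v) => [zv|_]; last by rewrite mulr0 addr0 subr0.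
  rewrite mulr1; apply: price_convex => //.
  by move: ltz; rewrite zv eq_sym (negPf vu) mulr0 subr0.
by rewrite !big_split /=; lra.
Qed.

End Factor.

(** * Weighted handshake identities *)

Lemma sum_inc (G : multigraph) (g : vertex G -> int) (e : edge G) :
  \sum_v g v * (inc e v)%:Z = g (ends e).1 + g (ends e).2.
Proof.
under eq_bigr do rewrite /inc PoszD mulrDr.
have pick w : \sum_v g v * (w == v)%:Z = g w.
  rewrite (bigD1 w) //= eqxx mulr1 big1 ?addr0 // => v; rewrite eq_sym => /negPf->.
  exact: mulr0.
by rewrite big_split /= !pick.
Qed.

Lemma sum_deg (G : multigraph) (g : vertex G -> int) (F : {set edge G}) :
  \sum_v g v * (deg F v)%:Z =
  \sum_(e in F) (g (ends e).1 + g (ends e).2).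
Proof.
under [RHS]eq_bigr do rewrite -sum_inc.
rewrite exchange_big /=; apply: eq_bigr => v _.
by rewrite -mulr_sumr /deg (big_morph _ PoszD (erefl _)).
Qed.

Lemma adj_edge (G : multigraph) (u w : vertex G) : adj setT u w ->
  exists e, forall v, inc e v = ((u == v) + (w == v))%N.
Proof.
case/exists_inP=> e _ uw; exists e => v; rewrite /inc.
by case/orP: uw => /eqP-> //=; rewrite addnC.
Qed.

(** * Structure of the minimisers for an extremal labelling *)

Section Optimal.
Variables (G : multigraph) (f : vertex G -> int).
Variables (c : {ffun vertex G -> option bool}) (m : int).
Implicit Types (u v w : vertex G) (e : edge G) (F H : {set edge G}).
Implicit Types (s : int).

Local Notation x := (excess f).
Local Notation total := (cost f c).

Hypothesis f_even : exists k : int, \sum_v f v = k * 2.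

(** Each price has the parity of the excess, and the excesses sum to twice the size of [F] minus the
    sum of [f]. *)
Lemma cost_even F : exists k : int, total F = k * 2.
Proof.
have half o y : price o y = y + (if o is Some true then 0
    else if o is None then (if y < 0 then - y else 0) else - y) * 2.
  case: o => [[]|] /=; [by ring|by ring|]; first by case: ltrP => hy; lia.
rewrite /cost; under eq_bigr do rewrite half.
rewrite big_split /= -mulr_suml sumrB.
have -> : \sum_v (deg F v)%:Z = #|F|%:Z * 2.
  have -> : \sum_v (deg F v)%:Z = \sum_v 1 * (deg F v)%:Z by apply: eq_bigr => v _; rewrite mul1r.
  by rewrite sum_deg sumr_const -mulr_natr natz; ring.
case: f_even => k ->; set S := (X in _ + X * 2).
by exists (#|F|%:Z - k + S); ring.
Qed.

Lemma cost_pair F H u w (k l : int) : u != w ->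
  (forall v, x H v = x F v + k * (u == v)%:Z + l * (w == v)%:Z) ->
  total H = total F - price (c u) (x F u) - price (c w) (x F w)
    + price (c u) (x F u + k) + price (c w) (x F w + l).
Proof.
move=> uw xH.
have costE K : total K = price (c u) (x K u) + price (c w) (x K w)
    + \sum_(v | (v != u) && (v != w)) price (c v) (x K v).
  by rewrite /cost (bigD1 u) //= (bigD1 w) //= 1?eq_sym // addrA.
rewrite !costE !xH !eqxx (negPf uw) eq_sym (negPf uw).
rewrite (eq_bigr (fun v => price (c v) (x F v))) => [|v /andP[vu vw]]; last first.
  by rewrite xH ![_ == v]eq_sym (negPf vu) (negPf vw) !mulr0 !addr0.
by rewrite !mulr0 !mulr1 !addr0; ring.
Qed.

Hypothesis m_gt0 : 0 < m.
Hypothesis m_min : forall F, m <= total F.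
(* By [cost_relabel], this says that giving [u] the label S or T would bring some
   total below [m]. *)
Hypothesis c_max : forall u s, c u = None -> s = 1 \/ s = -1 ->
  exists F, s * x F u < 0 /\ total F < m + `|x F u| * 2.

(** The factor given by [c_max] has the wanted sign at [u] but may not be a minimiser. Exchanging it
    with [F0] either exhibits a minimiser of that sign or shrinks [|x F u|] while keeping
    [total F < m + 2 |x F u|]. *)
Lemma opposite u s F0 : c u = None -> s = 1 \/ s = -1 ->
  total F0 = m -> 0 < s * x F0 u ->
  exists F, total F = m /\ s * x F u < 0.
Proof.
move=> cu hs opt0 xF0; have [F [xF ltF]] := c_max cu hs.
have [n] := ubnP `|x F u|%N.
elim: n => // n IHn in F xF ltF *; rewrite ltnS => le_n.
have [|H [H' [z [t [_ ht xHH' ltz]]]]] := @exchange G f c F F0 u s hs.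
  by case: hs xF xF0 => ->; lia.
have [xHu xH'u] := xHH' u; rewrite cu /= => le_cost.
have [kF evF] := cost_even F; have [kH' evH'] := cost_even H'.
have [k0 ev0] := cost_even F0.
have minH := m_min H; have minH' := m_min H'.
rewrite eqxx mulr1 in xHu xH'u.
(* If the trail returns to [u], the excess of [F0] may only go from [s] to [- s], saving nothing.
   Parity makes up for it: a cost other than [m] is at least [m + 2]. *)
case: (eqVneq z u) => [zu|zu].
  rewrite zu eqxx mulr1 in ltz xHu xH'u.
  have [opt|] := eqVneq (total F) m; first by exists F.
  have [opt'|] := eqVneq (total H') m.
    case: (ltrP (s * x H' u) 0) => [ltH'|]; first by exists H'.
    move=> geH' nopt; have [|] := ltrP (s * x H u) 0; last first.
      by case: hs xF xF0 ltz geH' xHu xH'u => ->; case: ht => ->; lia.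
    move=> ltH; apply: (IHn H) => //.
      by case: hs xF xF0 ltz ltH geH' xHu xH'u => ->; case: ht => ->; lia.
    by case: hs xF xF0 ltz ltH geH' xHu xH'u => ->; case: ht => ->; lia.
  move=> nopt' nopt.
  have [|ge0] := ltrP (s * x H u) 0; last first.
    by case: hs xF xF0 ltz ge0 xHu xH'u => ->; case: ht => ->; lia.
  move=> ltH; apply: (IHn H) => //.
    by case: hs xF xF0 ltz ltH xHu xH'u => ->; case: ht => ->; lia.
  by case: hs xF xF0 ltz ltH xHu xH'u => ->; case: ht => ->; lia.
rewrite (negPf zu) mulr0 in xHu xH'u.
have [|ge0] := ltrP (s * x H u) 0; last first.
  by case: hs xF xF0 ge0 xHu xH'u => ->; lia.
move=> ltH; apply: (IHn H) => //.
  by case: hs xF xF0 ltH xHu xH'u => ->; lia.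
by case: hs xF xF0 ltH xHu xH'u => ->; lia.
Qed.

(** Otherwise an exchange with a minimiser of opposite sign at [u] would lower the joint price at
    [u], hence the joint cost below [2m]. *)
Lemma unit_excess u F : c u = None -> total F = m -> `|x F u| <= 1.
Proof.
move=> cu opt; rewrite leNgt; apply/negP=> gt1.
have [s [hs xs]] : exists s, (s = 1 \/ s = -1) /\ 1 < s * x F u.
  by case: (ltrP 0 (x F u)) => h; [exists 1|exists (-1)]; split; lia.
have [F' [opt' xF']] : exists F', total F' = m /\ s * x F' u < 0.
  by apply: (opposite cu hs opt); lia.
have hs' : - s = 1 \/ - s = -1 by lia.
have [|H [H' [z [t [_ ht xHH' ltz]]]]] := @exchange G f c F F' u (- s) hs'.
  by case: hs xs xF' => ->; lia.
have [xHu xH'u] := xHH' u; rewrite cu /= => le_cost.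
have minH := m_min H; have minH' := m_min H'.
rewrite eqxx mulr1 in xHu xH'u.
case: (eqVneq z u) => zu; first rewrite zu eqxx in ltz xHu xH'u; last
    rewrite (negPf zu) in xHu xH'u.
  by case: hs xs xF' ltz xHu xH'u => ->; case: ht => ->; lia.
by case: hs xs xF' xHu xH'u => ->; lia.
Qed.

(** In an exchange with a minimiser of opposite sign at [u], a trail ending elsewhere would drop
    both prices at [u] from 1 to 0. So it returns to [u] and alters no other excess. *)
Lemma flip u F : c u = None -> total F = m -> x F u != 0 ->
  exists F', total F' = m /\ forall v, x F' v = x F v - 2 * x F u * (u == v)%:Z.
Proof.
move=> cu opt xu; have le1 := unit_excess cu opt.
have hs : x F u = 1 \/ x F u = -1 by lia.
have [F' [opt' xF']] : exists F', total F' = m /\ x F u * x F' u < 0.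
  by apply: (opposite cu hs opt); case: hs => ->.
have le1' := unit_excess cu opt'.
have hs' : - x F u = 1 \/ - x F u = -1 by lia.
have [|H [H' [z [t [_ ht xHH' ltz]]]]] := @exchange G f c F F' u (- x F u) hs'.
  by case: hs xF' => ->; lia.
have [xHu xH'u] := xHH' u; rewrite cu /= => le_cost.
have minH := m_min H; have minH' := m_min H'.
rewrite eqxx mulr1 in xHu xH'u.
case: (eqVneq z u) => zu; last first.
  rewrite (negPf zu) in xHu xH'u.
  by case: hs xF' xHu xH'u => ->; lia.
rewrite zu eqxx in ltz xHu xH'u.
have tE : t = - x F u by case: ht ltz => ->; case: hs xF' => ->; lia.
exists H; split; first by rewrite tE in xHu xH'u; case: hs xF' xHu xH'u => ->; lia.
by move=> v; rewrite (xHH' v).1 zu tE; ring.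
Qed.

(** If all minimisers had excess 0 at [w], toggling an edge [e] between [u] and [w] shows that those
    positive at [u] avoid [e] and those negative at [u] contain it. An exchange then yields a
    minimiser breaking this rule. *)
Lemma odd_spreads u w F1 : c u = None -> c w = None -> adj setT u w ->
  total F1 = m -> x F1 u != 0 -> exists F, total F = m /\ x F w != 0.
Proof.
move=> cu cw uw opt1 xu1.
have [/existsP[F /andP[/eqP opt xw]]|] := boolP [exists F, (total F == m) && (x F w != 0)].
  by exists F.
rewrite negb_exists => /forallP no.
have w0 F : total F = m -> x F w = 0.
  by move=> opt; have := no F; rewrite opt eqxx /= negbK => /eqP.
have neq_uw : u != w.
  by apply: contraNneq xu1 => ->; rewrite w0.
have [e incE] := adj_edge uw.
have notin F : total F = m -> 0 < x F u -> e \notin F.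
  move=> opt xF; apply/negP=> eF.
  have xH v : x (F :\ e) v = x F v + (-1) * (u == v)%:Z + (-1) * (w == v)%:Z.
    by rewrite /excess (degD1 v eF) incE; lia.
  have := cost_pair neq_uw xH; rewrite cu cw /= w0 // => costE.
  have := m_min (F :\ e) => minH.
  have := w0 (F :\ e); rewrite xH w0 // (negPf neq_uw) eqxx => h.
  have /h : total (F :\ e) = m by lia.
  by lia.
have isin F : total F = m -> x F u < 0 -> e \in F.
  move=> opt xF; apply/negPn/negP=> eF.
  have xH v : x (e |: F) v = x F v + 1 * (u == v)%:Z + 1 * (w == v)%:Z.
    by rewrite /excess (degU1 v eF) incE; lia.
  have := cost_pair neq_uw xH; rewrite cu cw /= w0 // => costE.
  have := m_min (e |: F) => minH.
  have := w0 (e |: F); rewrite xH w0 // (negPf neq_uw) eqxx => h.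
  have /h : total (e |: F) = m by lia.
  by lia.
have [F [opt xF]] : exists F, total F = m /\ 0 < x F u.
  case: (ltrP 0 (x F1 u)) => lt; first by exists F1.
  have [|F [opt xF]] := opposite cu (or_intror erefl) opt1; first by lia.
  by exists F; split=> //; lia.
have [F' [opt' xF']] : exists F', total F' = m /\ x F' u < 0.
  have [|F' [opt' xF']] := opposite cu (or_introl erefl) opt; first by lia.
  by exists F'; split=> //; lia.
have eF := notin F opt xF; have eF' := isin F' opt' xF'.
(* Adding [e] to [F] costs 2 and gives [w] excess 1. The exchange at [w] passes this excess to [H'],
   which then costs at least [m + 2], so [H] is a minimiser; it keeps the common edge [e] and is
   still positive at [u]. *)
have xK v : x (e |: F) v = x F v + 1 * (u == v)%:Z + 1 * (w == v)%:Z.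
  by rewrite /excess (degU1 v eF) incE; lia.
have costK := cost_pair neq_uw xK; rewrite cu cw /= in costK.
have xF0 := w0 F opt; have xF'0 := w0 F' opt'.
have xKw := xK w; rewrite eqxx (negPf neq_uw) xF0 in xKw.
have xKu := xK u; rewrite eqxx eq_sym (negPf neq_uw) in xKu.
have [|H [H' [z [t [sub_H ht xHH' ltz]]]]] := @exchange G f c (e |: F) F' w (-1) (or_intror erefl).
  by lia.
have [xHw xH'w] := xHH' w; rewrite cw /= => le_cost.
have [xHu _] := xHH' u.
have minH := m_min H; have minH' := m_min H'.
rewrite eqxx in xHw xH'w; rewrite eq_sym (negPf neq_uw) in xHu.
have zw : z != w by apply/eqP=> zw; move: ltz; rewrite zw eqxx; case: ht => ->; lia.
rewrite (negPf zw) in xHw xH'w.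
have nopt' : total H' != m by apply/eqP=> /w0; lia.
have [kK evK] := cost_even (e |: F); have [kH' evH'] := cost_even H'.
have [k ev] := cost_even F.
have optH : total H = m by lia.
have eH : e \in H by apply: (subsetP sub_H); rewrite !inE eqxx eF'.
suff /(notin H optH) : 0 < x H u by rewrite eH.
by case: eqP xHu; case: ht => ->; lia.
Qed.

(** For opposite signs, toggling the edge between [p] and [q] keeps the cost but leaves one end with
    excess 2 in absolute value, against [unit_excess]. Equal signs are made opposite by [flip]. *)
Lemma adjacent_excess p q F : c p = None -> c q = None -> p != q ->
  adj setT p q -> total F = m -> x F p != 0 -> x F q = 0.
Proof.
move=> cp cq pq adj_pq opt xp; apply/eqP/negPn/negP=> xq.
have [e incE] := adj_edge adj_pq.
have contra F1 : total F1 = m -> x F1 p * x F1 q = -1 -> False.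
  move=> opt1 xx.
  have lep := unit_excess cp opt1; have leq := unit_excess cq opt1.
  have [eF|eF] := boolP (e \in F1).
    have xH v : x (F1 :\ e) v = x F1 v + (-1) * (p == v)%:Z + (-1) * (q == v)%:Z.
      by rewrite /excess (degD1 v eF) incE; lia.
    have := cost_pair pq xH; rewrite cp cq /= => costE.
    have minH := m_min (F1 :\ e).
    have optH : total (F1 :\ e) = m by nia.
    have := unit_excess cp optH; have := unit_excess cq optH.
    by rewrite !xH !eqxx (negPf pq) eq_sym (negPf pq); nia.
  have xH v : x (e |: F1) v = x F1 v + 1 * (p == v)%:Z + 1 * (q == v)%:Z.
    by rewrite /excess (degU1 v eF) incE; lia.
  have := cost_pair pq xH; rewrite cp cq /= => costE.
  have minH := m_min (e |: F1).
  have optH : total (e |: F1) = m by nia.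
  have := unit_excess cp optH; have := unit_excess cq optH.
  by rewrite !xH !eqxx (negPf pq) eq_sym (negPf pq); nia.
have lep := unit_excess cp opt; have leq := unit_excess cq opt.
have [opp|same] := eqVneq (x F p * x F q) (-1); first exact: contra opp.
have [F' [opt' xF']] := flip cp opt xp.
apply: (contra F' opt'); rewrite !xF' eqxx (negPf pq) mulr0 subr0.
have hp : x F p = 1 \/ x F p = -1 by lia.
have hq : x F q = 1 \/ x F q = -1 by lia.
by case: hp same => ->; case: hq => ->.
Qed.

Definition free_adj : rel (vertex G) :=
  [rel u v | [&& c u == None, c v == None & adj setT u v]].

(** Induction on a path from [p] to [q], as for Gallai's lemma: [F] is exchanged with a minimiser of
    nonzero excess at the second vertex [r]. *)
Lemma component_excess p q F : p != q -> connect free_adj p q ->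
  total F = m -> x F p != 0 -> x F q = 0.
Proof.
move=> pq /connectP[l path_l last_l] opt xp; apply/eqP/negPn/negP=> xq.
elim: l => [|r l IHl] in p F path_l last_l pq opt xp xq *.
  by rewrite last_l eqxx in pq.
case/andP: path_l => /and3P[/eqP cp /eqP cr adj_pr] path_l /=.
have [rp|rp] := eqVneq r p; first by apply: (IHl p F); rewrite // -rp.
rewrite eq_sym in rp.
have adj0 K : total K = m -> x K p != 0 -> x K r = 0.
  exact: adjacent_excess.
have [rq|rq] := eqVneq r q; first by rewrite -rq adj0 ?eqxx in xq.
have xr := adj0 _ opt xp.
have [F' [opt' xr']] := odd_spreads cp cr adj_pr opt xp.
have xp' : x F' p = 0.
  by apply/eqP; apply: contraNT xr' => /adj0->.
have xq' : x F' q = 0.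
  by apply/eqP/negPn/negP=> xq'; apply: (IHl r F').
have le1 := unit_excess cr opt'.
have hs : x F' r = 1 \/ x F' r = -1 by lia.
have [|H [H' [z [t [_ ht xHH' ltz]]]]] := @exchange G f c F F' r (x F' r) hs.
  by rewrite xr; case: hs => ->.
have [xHr xH'r] := xHH' r; rewrite cr /= => le_cost.
have minH := m_min H; have minH' := m_min H'.
have zr : z != r.
  by apply/eqP=> zr; move: ltz; rewrite zr eqxx xr mulr1 subr0 subrr mulr0.
rewrite eqxx (negPf zr) xr in xHr xH'r.
(* The prices 0 and 1 at [r] are merely swapped, so [H] is a minimiser, now nonzero at [r]. It must
   vanish at [p], so the trail ended at [p] and left [q] untouched, against the induction hypothesis
   from [r]. *)
have optH : total H = m by lia.
have xHr0 : x H r != 0 by lia.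
have zp : z = p.
  apply/eqP; apply: contraNT xHr0 => zp; rewrite adj0 //.
  by rewrite (xHH' p).1 (eq_sym r) (negPf rp) (negPf zp) !mulr0 !addr0.
apply: (IHl r H) => //.
by rewrite (xHH' q).1 (negPf rq) zp (negPf pq) !mulr0 !addr0.
Qed.

End Optimal.

(** * The extremal labelling and a normalised minimiser *)

Definition side (o : option bool) : int :=
  match o with Some true => 1 | Some false => -1 | None => 0 end.

Section Barrier.
Variables (G : multigraph) (f : vertex G -> int).
Implicit Types (c : {ffun vertex G -> option bool}).
Implicit Types (u v w : vertex G) (e : edge G) (F H : {set edge G}).

Lemma cost_relabel c u s F : c u = None -> s = 1 \/ s = -1 ->
  cost f [ffun v => if v == u then Some (s == 1) else c v] F =
  cost f c F - `|excess f F u| + s * excess f F u.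
Proof.
move=> cu hs; rewrite /cost (bigD1 u) //= [in RHS](bigD1 u) //= ffunE eqxx cu /=.
have -> : (if s == 1 then excess f F u else - excess f F u) = s * excess f F u.
  by case: hs => -> /=; lia.
rewrite (eq_bigr (fun v => price (c v) (excess f F v))); first by ring.
by move=> v /negPf vu; rewrite ffunE vu.
Qed.

(** Deleting S-S and S-U edges and adding T-T and T-U edges is never a loss: what an S or T end
    gains pays for a U end. The condition is phrased with signs so that it can be summed over all
    edges. *)
Lemma normalize c F : exists F', cost f c F' <= cost f c F /\
  forall e, let a := side (c (ends e).1) + side (c (ends e).2) in
    (if e \in F' then a else - a) = - `|a|.
Proof.
pose a e := side (c (ends e).1) + side (c (ends e).2).
pose A := [set e | 0 < a e]; pose B := [set e | a e < 0].
exists (F :\: A :|: B); split; last first.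
  move=> e /=; rewrite !inE -/(a e).
  by case: (ltrP 0 (a e)) => h1; case: (ltrP (a e) 0) => h2 //=;
    rewrite ?orbT ?orbF; first [lia | by case: ifP => _; lia].
(* [gA] and [gB] bound the rise in price at [v] per deleted, respectively added, half-edge. *)
pose gA v : int := if c v == Some true then -1 else 1.
pose gB v : int := if c v == Some false then -1 else 1.
have degE' v : (deg (F :\: A :|: B) v)%:Z =
    (deg F v)%:Z - (deg (F :&: A) v)%:Z + (deg (B :\: F) v)%:Z.
  rewrite !degE !(big_morph _ PoszD (erefl _)) -sumrB -big_split /=.
  apply: eq_bigr => e _; rewrite !inE; case: (e \in F) => /=;
    case: (ltrP 0 (a e)) => h1; case: (ltrP (a e) 0) => h2 //=; lia.
have -> : cost f c F = cost f c F + 0 by rewrite addr0.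
apply: (@le_trans _ _ (\sum_v (price (c v) (excess f F v)
    + gA v * (deg (F :&: A) v)%:Z + gB v * (deg (B :\: F) v)%:Z))).
  apply: ler_sum => v _; rewrite /excess degE' /gA /gB.
  by case: (c v) => [[]|] /=; lia.
rewrite !big_split /= -addrA lerD2l !sum_deg.
have leA : \sum_(e in F :&: A) (gA (ends e).1 + gA (ends e).2) <= 0.
  apply: sumr_le0 => e; rewrite !inE => /andP[_]; rewrite /a /gA.
  by case: (c _) => [[]|]; case: (c _) => [[]|].
have leB : \sum_(e in B :\: F) (gB (ends e).1 + gB (ends e).2) <= 0.
  apply: sumr_le0 => e; rewrite !inE => /andP[_]; rewrite /a /gB.
  by case: (c _) => [[]|]; case: (c _) => [[]|].
lia.
Qed.

Lemma barrier : (exists k : int, \sum_v f v = k * 2) ->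
  (forall F, exists v, excess f F v != 0) ->
  exists c F, [/\ 1 < cost f c F,
    forall e, let a := side (c (ends e).1) + side (c (ends e).2) in
      (if e \in F then a else - a) = - `|a|,
    forall v, c v = None -> `|excess f F v| <= 1 &
    forall p q, p != q -> connect (free_adj c) p q ->
      excess f F p != 0 -> excess f F q = 0].
Proof.
move=> f_even no_factor.
pose good c := [forall F, 0 < cost f c F].
have good0 : good [ffun=> None].
  apply/forallP=> F; have [v xv] := no_factor F; rewrite /cost (bigD1 v) //= ffunE /=.
  by apply: ltr_pwDl; rewrite ?normr_gt0 // sumr_ge0 // => w _; rewrite ffunE /=.
pose labelled c := #|[set v | c v != None]|.
have [c /forallP c_good c_max] := arg_maxnP labelled good0.
(* All costs under [c] are positive, so passing to absolute values only serves to minimise over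
   natural numbers. *)
have [F _ F_min] := @arg_minnP _ set0 predT (fun F => `|cost f c F|%N) isT.
pose m := cost f c F.
have m_gt0 : 0 < m := c_good F.
have m_min H : m <= cost f c H by have := F_min H isT; have := c_good H; rewrite /m; lia.
(* By maximality of [c], labelling [u] creates a factor of nonpositive cost; as its cost under [c]
   is positive, its excess at [u] has the sign opposite to [s]. *)
have relabel u s : c u = None -> s = 1 \/ s = -1 ->
    exists H, s * excess f H u < 0 /\ cost f c H < m + `|excess f H u| * 2.
  move=> cu hs; pose c' := [ffun v => if v == u then Some (s == 1) else c v].
  have /forallPn[H] : ~~ good c'.
    apply/negP=> /c_max /=; rewrite /labelled leqNgt => /negP; apply.
    apply: proper_card; apply/properP; split.
      by apply/subsetP=> v; rewrite !inE /c' ffunE; case: (v == u).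
    by exists u; rewrite !inE ?ffunE ?eqxx ?cu.
  rewrite -leNgt cost_relabel // => le0; exists H; have := c_good H.
  by case: hs le0 => ->; lia.
have [F' [le_cost normF']] := normalize c F.
have optF' : cost f c F' = m by apply/eqP; rewrite eq_le le_cost m_min.
exists c, F'; split=> //.
- by have [k] := cost_even c f_even F'; rewrite optF'; lia.
- by move=> v cv; apply: (unit_excess f_even m_gt0 m_min relabel cv optF').
- by move=> p q pq conn; apply: (component_excess f_even m_gt0 m_min relabel pq conn optF').
Qed.

End Barrier.

(** * Parity and size of edge cuts *)

Lemma sum_indicator (T : finType) (K : {set T}) w (b : bool) :
  (\sum_(v in K) ((w == v) && b) = (w \in K) && b)%N.
Proof.
have [wK|wK] := boolP (w \in K).
  by rewrite (bigD1 w) //= eqxx big1 ?addn0 // => v /andP[_]; rewrite eq_sym => /negPf->.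
by rewrite big1 // => v vK; case: eqP wK => // ->; rewrite vK.
Qed.

Section Cuts.
Variable G : multigraph.
Implicit Types (K X : {set vertex G}) (e : edge G).

Definition cut K : {set edge G} :=
  [set e | ((ends e).1 \in K) (+) ((ends e).2 \in K)].

Lemma sum_deg_nat K (F : {set edge G}) :
  (\sum_(v in K) deg F v = \sum_(e in F) (((ends e).1 \in K) + ((ends e).2 \in K)))%N.
Proof.
have ind w : (\sum_(v in K) (w == v) = (w \in K))%N.
  by under eq_bigr do rewrite -[_ == _]andbT; rewrite sum_indicator andbT.
by rewrite /deg exchange_big; apply: eq_bigr => e _; rewrite big_split /= !ind.
Qed.

Lemma cut_even K : eulerian G -> ~~ odd #|cut K|.
Proof.
move=> eulG; have : ~~ odd (\sum_(v in K) deg setT v).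
  by elim/big_rec: _ => // v n _ even_n; rewrite oddD (negPf (eulG v)).
suff -> : odd (\sum_(v in K) deg setT v) = odd #|cut K| by [].
rewrite sum_deg_nat -sum1_card big_mkcond [in RHS]big_mkcond /=.
rewrite !(big_morph odd oddD (erefl _)); apply: eq_bigr => e _.
by rewrite !inE; case: (_ \in K); case: (_ \in K).
Qed.

Lemma cut_separates K (S : {set edge G}) p q : cut K \subset S -> p \in K -> q \notin K ->
  ~ connected (~: S).
Proof.
move=> cutS pK qK /(_ p q) conn; move: qK; rewrite -(closed_connect _ conn) ?pK //.
move=> u v /exists_inP[e]; rewrite inE => eS uv.
have : e \notin cut K by apply: contra eS; exact: (subsetP cutS).
by rewrite inE; case/orP: uv => /eqP-> /=; case: (_ \in K); case: (_ \in K).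
Qed.

(** The second bound comes from connectivity and matters when [k = 0]. *)
Lemma cut_card K k p q : edge_connected G k -> p \in K -> q \notin K ->
  (k <= #|cut K|)%N /\ (0 < #|cut K|)%N.
Proof.
move=> [conn0 conn] pK qK; split; rewrite leqNgt; apply/negP.
  by move/conn; apply: cut_separates pK qK.
rewrite ltnS leqn0 cards_eq0 => /eqP cut0.
by apply: (cut_separates (S := set0) _ pK qK); rewrite ?cut0 ?setC0.
Qed.

End Cuts.

(** * Components of [G[U]] and the edges leaving them *)

Section Count.
Variables (G : multigraph) (c : {ffun vertex G -> option bool}).
Implicit Types (u v w : vertex G) (e : edge G) (F : {set edge G}).

(** Summed over U, this counts the edges between U and the labelled vertices; a loop at an
    unlabelled vertex contributes 0. *)
Definition half_edges_out v : nat :=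
  \sum_e (((ends e).1 == v) && (c (ends e).2 != None)
        + ((ends e).2 == v) && (c (ends e).1 != None)).

Lemma sum_half_edges_out (K : {set vertex G}) :
  (\sum_(v in K) half_edges_out v =
   \sum_e (((ends e).1 \in K) && (c (ends e).2 != None)
          + ((ends e).2 \in K) && (c (ends e).1 != None)))%N.
Proof.
rewrite /half_edges_out exchange_big; apply: eq_bigr => e _.
by rewrite big_split /= !sum_indicator.
Qed.

(** Components are indexed by canonical roots; the set is empty if [r] is not the root of an
    unlabelled vertex. *)
Definition component r : {set vertex G} :=
  [set v | (c v == None) && (fingraph.root (free_adj c) v == r)].

Lemma free_adj_sym : connect_sym (free_adj c).
Proof.
apply: sym_connect_sym => u v; rewrite /free_adj /= andbCA; congr [&& _, _ & _].
by apply: eq_existsb => e; rewrite orbC.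
Qed.

Lemma sum_component F f r :
  (forall v, c v = None -> `|excess f F v| <= 1) ->
  (forall p q, p != q -> connect (free_adj c) p q ->
    excess f F p != 0 -> excess f F q = 0) ->
  \sum_(v in component r) `|excess f F v| <= 1.
Proof.
move=> le1 atmost1.
have [/exists_inP[p pK xp]|] := boolP [exists p in component r, excess f F p != 0].
  rewrite (bigD1 p) //= big1 ?addr0; first by apply: le1; move: pK; rewrite inE => /andP[/eqP].
  move=> q /andP[qK qp]; rewrite (atmost1 p q) ?normr0 // 1?eq_sym //.
  move: pK qK; rewrite !inE => /andP[_ /eqP rp] /andP[_ /eqP rq].
  by rewrite -(root_connect free_adj_sym) rp rq.
rewrite negb_exists_in => /forall_inP no; rewrite big1 // => v /no.
by rewrite negbK => /eqP->; rewrite normr0.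
Qed.

(** An edge leaving a component ends at a labelled vertex, since an unlabelled end would belong to
    the same component. *)
Lemma cut_component r :
  (#|cut (component r)| <= \sum_(v in component r) half_edges_out v)%N.
Proof.
pose K := component r.
have leave a b : adj setT a b -> a \in K -> b \notin K -> c b != None.
  move=> ab; rewrite !inE => /andP[ca /eqP ra]; apply: contra => cb; rewrite cb /=.
  rewrite -ra; apply/eqP; symmetry; apply/(fingraph.rootP free_adj_sym)/connect1.
  by rewrite /free_adj /= ca cb.
rewrite sum_half_edges_out -sum1_card big_mkcond /=; apply: leq_sum => e _.
rewrite inE -/K.
have adj12 : adj setT (ends e).1 (ends e).2.
  by apply/exists_inP; exists e; rewrite // -surjective_pairing eqxx.
have adj21 : adj setT (ends e).2 (ends e).1.
  by apply/exists_inP; exists e; rewrite // -surjective_pairing eqxx orbT.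
have := leave _ _ adj12; have := leave _ _ adj21.
by case: (_ \in K); case: (_ \in K) => //= h1 h2; rewrite ?h1 ?h2.
Qed.

End Count.

(** * Degree counting for the target [d/2 + i] *)

Section Balance.
Variables (G : multigraph) (i : vertex G -> int).
Hypothesis G_eulerian : eulerian G.

Definition target v : int := (deg [set: edge G] v)./2%:Z + i v.

(** The halved degrees sum to the number of edges, and the sum of [i] has the parity of [t]. *)
Lemma target_even t : t = (\sum_v `|i v|)%N -> #|edge G| = t %[mod 2] ->
  exists k : int, \sum_v target v = k * 2.
Proof.
move=> t_def parity; rewrite /target big_split /=.
have : \sum_v 1 * (deg [set: edge G] v)%:Z = #|edge G|%:Z * 2.
  by rewrite sum_deg sumr_const cardsT -mulr_natr natz; ring.
rewrite (eq_bigr (fun v => (deg [set: edge G] v)./2%:Z * 2)); last first.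
  by move=> v _; have := odd_double_half (deg [set: edge G] v);
    rewrite (negPf (G_eulerian v)); lia.
rewrite -mulr_suml => halves.
have : t%:Z = \sum_v (i v + (if i v < 0 then - i v else 0) * 2).
  rewrite t_def (big_morph _ PoszD (erefl _)); apply: eq_bigr => v _.
  by case: ltrP => h; lia.
rewrite big_split /= -mulr_suml => abs_i.
have solve (e r : nat) (h s n : int) : h * 2 = e%:Z * 2 -> r%:Z = s + n * 2 ->
  e = r %[mod 2] -> exists k : int, h + s = k * 2.
  by move=> ? ? ?; exists (((e + r) %/ 2)%N%:Z - n); lia.
exact: solve halves abs_i parity.
Qed.

(** Summing the normalisation over all edges evaluates twice the [side]-weighted degree sum of [F]
    minus that of [G]. The sum of [|a|] is [2 e(S) + 2 e(T) + d(U)]. *)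
Lemma cost_balance (c : {ffun vertex G -> option bool}) (F : {set edge G}) :
  (forall e, let a := side (c (ends e).1) + side (c (ends e).2) in
    (if e \in F then a else - a) = - `|a|) ->
  cost target c F * 2 = - (\sum_e `|side (c (ends e).1) + side (c (ends e).2)|)
    - (\sum_v side (c v) * i v) * 2
    + (\sum_(v | c v == None) `|excess target F v|) * 2.
Proof.
move=> normF.
rewrite -sumrN; under [X in _ = X - _ + _]eq_bigr do rewrite -normF /=.
have -> : \sum_e (if e \in F then side (c (ends e).1) + side (c (ends e).2)
      else - (side (c (ends e).1) + side (c (ends e).2))) =
    (\sum_v side (c v) * (deg F v)%:Z) * 2 - \sum_v side (c v) * (deg setT v)%:Z.
  rewrite !(sum_deg (fun v => side (c v))) mulr_suml.
  rewrite [X in _ = X - _]big_mkcond [X in _ = _ - X]big_mkcond /=.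
  by rewrite -sumrB; apply: eq_bigr => e _; rewrite inE; case: ifP => _; ring.
rewrite [X in _ + X * 2]big_mkcond /= /cost !mulr_suml -!sumrB -big_split /=.
apply: eq_bigr => v _; rewrite /excess /target.
have := odd_double_half (deg [set: edge G] v); rewrite (negPf (G_eulerian v)).
by case: (c v) => [[]|] /=; lia.
Qed.

End Balance.

(** * Contradiction in the three cases: U empty, U everything, U proper *)

Theorem theorem2p2 (G : multigraph) (i : vertex G -> int) (t : nat)
  (t_def : t = (\sum_(v : vertex G) absz (i v))%N)
  (G_eulerian : eulerian G)
  (G_parity : #|edge G| = t %[mod 2])
  (G_conn : edge_connected G (2 * t - 1)%N)
  (G_bi : (t - 1 <= bi G)%N) :
  exists F : {set edge G},
    forall v : vertex G,
      ((deg F v)%:Z = (deg [set: edge G] v)./2%:Z + i v)%R.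
Proof.
have [/existsP[F /forallP hF]|no_factor] :=
    boolP [exists F : {set edge G}, [forall v, excess (target i) F v == 0]].
  by exists F => v; apply/eqP; rewrite -subr_eq0; exact: hF.
exfalso.
have [|c [F [gt1 normF le1 atmost1]]] := barrier (target_even G_eulerian t_def G_parity).
  move=> F; apply/existsP; apply: contraNT no_factor => /existsPn no.
  by apply/existsP; exists F; apply/forallP=> v; have := no v; rewrite negbK.
have balance := cost_balance i G_eulerian normF.
have le_i : - (\sum_v side (c v) * i v) <= t%:Z.
  rewrite t_def (big_morph _ PoszD (erefl _)) -sumrN; apply: ler_sum => v _.
  by case: (c v) => [[]|] /=; lia.
pose free := [set v | c v == None].
have [free0|[p]] := set_0Vmem free.
  have noneF v : (c v == None) = false.
    by have /setP/(_ v) := free0; rewrite !inE.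
  (* S and T now form a bipartition, and exactly the edges inside a part have nonzero [|a|], equal
     to 2. Hence the cost is at most [t - bi G]. *)
  pose X := [set v | c v == Some true].
  have le_bi : (bi G <= bip_defect X)%N.
    by rewrite /bi; case: arg_minnP => // Y _; apply.
  have : \sum_e `|side (c (ends e).1) + side (c (ends e).2)| = (bip_defect X)%:Z * 2.
    rewrite /bip_defect -!sum1_card !(big_mkcond (fun e => e \in _)) -big_split /=.
    rewrite (big_morph _ PoszD (erefl _)) mulr_suml; apply: eq_bigr => e _.
    rewrite !inE; move: (noneF (ends e).1) (noneF (ends e).2).
    by case: (c _) => [[]|] // _; case: (c _) => [[]|].
  move=> sum_a; rewrite (big_pred0 _ _ _ _ noneF) in balance.
  by lia.
rewrite inE => /eqP cp.
have sum_le1 r := sum_component r le1 atmost1.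
have [/forallP all_free|] := boolP [forall v, c v == None].
  have conn q : connect (free_adj c) p q.
    rewrite -(eq_connect (e := adj setT)); first exact: G_conn.1.
    by move=> u v; rewrite /free_adj /= !all_free.
  have := sum_le1 (fingraph.root (free_adj c) p).
  rewrite (eq_bigl xpredT) => [|v]; last first.
    rewrite inE all_free eq_sym.
    by apply/eqP/(fingraph.rootP (free_adj_sym c)).
  suff -> : \sum_v `|excess (target i) F v| = cost (target i) c F by rewrite leNgt gt1.
  by apply: eq_bigr => v _; rewrite (eqP (all_free v)).
rewrite negb_forall => /existsP[q cq].
have le_out : \sum_(v | c v == None) (half_edges_out c v)%:Z
    <= \sum_e `|side (c (ends e).1) + side (c (ends e).2)|.
  rewrite -(big_morph _ PoszD (erefl _)) (eq_bigl (fun v => v \in free)); last first.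
    by move=> v; rewrite inE.
  rewrite sum_half_edges_out (big_morph _ PoszD (erefl _)); apply: ler_sum => e _.
  by rewrite !inE; case: (c _) => [[]|]; case: (c _) => [[]|].
(* Evenness lifts [2t - 1] to [2t]. For [t = 0] the truncated difference is 0, and a nonempty even
   cut supplies the bound 2. *)
have big_cut r v : v \in component c r ->
    (2 * t <= #|cut (component c r)|)%N /\ (2 <= #|cut (component c r)|)%N.
  move=> vK; have qK : q \notin component c r by rewrite inE (negPf cq).
  have [ge gt] := cut_card G_conn vK qK.
  by have := cut_even (component c r) G_eulerian; lia.
(* Over one component the [gain] is at least [max(2t, 2) - 2]: the component of [p] secures
   [2t - 2], and the others add nonnegative amounts. *)
pose gain v : int := (half_edges_out c v)%:Z - `|excess (target i) F v| * 2.
have sum_gain r : \sum_(v in component c r) gain v =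
    (\sum_(v in component c r) half_edges_out c v)%N%:Z
    - (\sum_(v in component c r) `|excess (target i) F v|) * 2.
  by rewrite (big_morph _ PoszD (erefl _)) mulr_suml sumrB.
have gain_component r v : v \in component c r ->
    0 <= \sum_(v in component c r) gain v /\
    (2 * t)%:Z - 2 <= \sum_(v in component c r) gain v.
  move=> vK; rewrite sum_gain; have [ge gt] := big_cut r v vK.
  by have := cut_component c r; have := sum_le1 r; lia.
have : (2 * t)%:Z - 2 <= \sum_(v | c v == None) gain v /\ 0 <= \sum_(v | c v == None) gain v.
  rewrite (partition_big (fingraph.root (free_adj c)) predT) //=.
  rewrite (bigD1 (fingraph.root (free_adj c) p)) //=.
  have in_component r : \sum_(v | (c v == None) && (fingraph.root (free_adj c) v == r)) gain v
      = \sum_(v in component c r) gain v by apply: eq_bigl => v; rewrite inE.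
  rewrite in_component.
  have [|ge0 ge] := @gain_component (fingraph.root (free_adj c) p) p.
    by rewrite inE cp !eqxx.
  suff rest : 0 <= \sum_(r | r != fingraph.root (free_adj c) p)
      \sum_(v | (c v == None) && (fingraph.root (free_adj c) v == r)) gain v.
    by split; [exact: ler_wpDr | exact: addr_ge0].
  apply: sumr_ge0 => r _; rewrite in_component.
  have [->|[v vK]] := set_0Vmem (component c r); first by rewrite big_set0.
  by have [] := gain_component r v vK.
rewrite /gain sumrB -mulr_suml => -[ge ge0].
have absurd (o y a b k : int) : o <= a -> (2 * t)%N%:Z - 2 <= o - y * 2 ->
  0 <= o - y * 2 -> 1 < k -> k * 2 = - a - b * 2 + y * 2 -> - b <= t%:Z -> False by lia.
exact: absurd le_out ge ge0 gt1 balance le_i.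
Qed.
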